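(* Let $u\in\mathbb{R}^3$ be a unit vector, let $\theta\in(0,\pi/2]$, and let $$A=\{g\in \mathrm{SO}(3,\mathbb{R}): \angle(u,gu)<\theta\}.$$ Then $$\mu(A^2)=4\mu(A)\bigl(1-\mu(A)\bigr).$$ In particular, $\mu(A^2)<4\mu(A)$, and the measure of such $A$ can be arbitrarily small (that is, for every $\delta>0$ there is $A$ of this form with $\mu(A)<\delta$).
   Context: $\mathrm{SO}(3,\mathbb{R})$ is the group of real orthogonal $3\times3$ matrices of determinant $1$, with normalized Haar measure $\mu$. For unit vectors $u,v\in\mathbb{R}^3$, $\angle(u,v)=\arccos(u\cdot v)\in[0,\pi]$ is the angle between them, and $gu$ is the image of $u$ under $g$. $A^2=\{ab: a,b\in A\}$ is the product set. *)

(* Defs.v *)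
From HB Require Import structures.
From mathcomp Require Import all_boot all_order all_algebra.
From mathcomp Require Import all_classical all_reals all_analysis.

Set Implicit Arguments.
Unset Strict Implicit.
Unset Printing Implicit Defensive.

Import Order.TTheory GRing.Theory Num.Theory.
Import numFieldNormedType.Exports.

Local Open Scope classical_set_scope.
Local Open Scope ring_scope.

(* The norm `|_| that the library puts on 'cV[R]_n is the sup norm, hence the
   separate Euclidean norm. *)
Definition dot (R : realType) n (u v : 'cV[R]_n) : R :=
  \sum_(i < n) u i ord0 * v i ord0.

Definition euclidean_norm (R : realType) n (u : 'cV[R]_n) : R :=
  Num.sqrt (dot u u).

Definition unit_vector (R : realType) n (u : 'cV[R]_n) : Prop :=
  euclidean_norm u = 1.

Definition angle (R : realType) n (u v : 'cV[R]_n) : R := acos (dot u v).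

Record SO3 (R : realType) := MkSO3 {
  SO3_mx :> 'M[R]_3;
  SO3P : (SO3_mx *m SO3_mx^T == 1%:M) && (\det SO3_mx == 1) }.

Section SO3_structures.
Context (R : realType).

HB.instance Definition _ := [isSub for @SO3_mx R].
HB.instance Definition _ := [Choice of SO3 R by <:].

Fact SO3_one_subproof :
  ((1%:M : 'M[R]_3) *m (1%:M)^T == 1%:M) && (\det (1%:M : 'M[R]_3) == 1).
Proof. by rewrite trmx1 mulmx1 det1 !eqxx. Qed.
Definition SO3_one : SO3 R := MkSO3 SO3_one_subproof.

Fact SO3_mul_subproof (g h : SO3 R) :
  ((g *m h) *m (g *m h)^T == 1%:M) && (\det (g *m h) == 1).
Proof.
case: g h => [g /= /andP[/eqP gO /eqP gD]] [h /= /andP[/eqP hO /eqP hD]].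
by rewrite trmx_mul mulmxA -(mulmxA g) hO mulmx1 gO det_mulmx gD hD mulr1 !eqxx.
Qed.
Definition SO3_mul (g h : SO3 R) : SO3 R := MkSO3 (SO3_mul_subproof g h).

Fact SO3_inv_subproof (g : SO3 R) :
  ((SO3_mx g)^T *m (SO3_mx g)^T^T == 1%:M) && (\det (SO3_mx g)^T == 1).
Proof.
case: g => [g /= /andP[/eqP gO /eqP gD]].
by rewrite trmxK (mulmx1C gO) det_tr gD !eqxx.
Qed.
Definition SO3_inv (g : SO3 R) : SO3 R := MkSO3 (SO3_inv_subproof g).

Fact SO3_mulA : associative SO3_mul.
Proof. by move=> f g h; apply: val_inj; rewrite /= mulmxA. Qed.
Fact SO3_mul1 : left_id SO3_one SO3_mul.
Proof. by move=> g; apply: val_inj; rewrite /= mul1mx. Qed.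
Fact SO3_mulr1 : right_id SO3_one SO3_mul.
Proof. by move=> g; apply: val_inj; rewrite /= mulmx1. Qed.
Fact SO3_mulrV : right_inverse SO3_one SO3_inv SO3_mul.
Proof. by move=> g; apply: val_inj => /=; have /andP[/eqP] := SO3P g. Qed.
Fact SO3_mulV : left_inverse SO3_one SO3_inv SO3_mul.
Proof.
by move=> g; apply: val_inj => /=; have /andP[/eqP/mulmx1C] := SO3P g.
Qed.

HB.instance Definition _ :=
  isGroup.Build (SO3 R) SO3_mulA SO3_mul1 SO3_mulr1 SO3_mulV SO3_mulrV.
HB.instance Definition _ := isPointed.Build (SO3 R) SO3_one.

(* The topology induced by 'M[R]_3, and its Borel sigma-algebra. *)
HB.instance Definition _ :=
  Topological.copy (SO3 R) (initial_topology (@SO3_mx R)).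
HB.instance Definition _ :=
  Measurable.copy (SO3 R) (g_sigma_algebraType (@open (SO3 R))).

End SO3_structures.

Definition prodset (G : groupType) (A B : set G) : set G :=
  [set (a * b)%g | a in A & b in B].

(* Left invariance together with total mass 1 (the type [probability])
   characterizes the normalized Haar measure, which is bi-invariant since
   SO(3) is compact; regularity is automatic on this compact metric space. *)
Definition normalized_Haar (R : realType) (mu : probability (SO3 R) R) : Prop :=
  forall (g : SO3 R) (B : set (SO3 R)),
    measurable B -> mu [set (g * x)%g | x in B] = mu B.

Definition rotation_nbhd (R : realType) (u : 'cV[R]_3) (theta : R) :
    set (SO3 R) :=
  [set g | angle u (SO3_mx g *m u) < theta].

(* Main.v *)
Require Import Defs.
From mathcomp Require Import all_boot all_order all_algebra.
From mathcomp Require Import all_classical all_reals all_analysis.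
From mathcomp Require Import measurable_realfun ring lra.
Import Order.TTheory GRing.Theory Num.Theory.
Local Open Scope classical_set_scope.
Local Open Scope ring_scope.

(** By Archimedes' hat-box theorem, the projection of a uniform point of the
    sphere to an axis is uniform on [-1, 1].  Here the point is [g u] with [g]
    distributed according to [mu], so that the cap [{g | t < u . g u}] has
    measure [(1 - t) / 2] ([Haar_cap]).  The set [A] is the cap of height
    [c = cos theta], and [A^2] is the cap of height
    [cos (2 theta) = 2 c^2 - 1] ([prodset_rotation_cap]); hence
    [mu (A^2) = 1 - c^2 = 4 * ((1 - c) / 2) * ((1 + c) / 2)].

    Only the left invariance of [mu] is given, so the hat-box theorem is derived
    from it by moments.  Since SO(3) is transitive on the sphere
    ([SO3_transitive]), the law of the coordinate [w . g u] is the same for all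
    unit vectors [w] ([Haar_law]).  For orthonormal [e] and [f], the moment of
    order [2k] of the coordinate along [f + a e] is therefore
    [(1 + a^2)^k m_(2k)] for every real [a]; comparing the coefficients of [a^2]
    ([mixed_moment]) and summing over the coordinate axes gives
    [(2k + 3) m_(2k+2) = (2k + 1) m_(2k)] ([moment_rec]).  With the vanishing of
    the odd moments, this says that the mean of [q'] is [(q(1) - q(-1)) / 2] for
    every polynomial [q] ([mean_deriv]).

    It remains to see that these moments determine the law ([uniform_tail]).
    The Bernstein polynomials of a step function approximate the step
    ([bernstein_step_lower], which is Chebyshev's inequality for the binomial
    law), and their means are read off exactly from the fact that the derivative
    of a Bernstein polynomial is the Bernstein polynomial of the difference
    sequence ([deriv_bernstein]). *)

Set Implicit Arguments.
Unset Strict Implicit.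
Unset Printing Implicit Defensive.
Import numFieldNormedType.Exports.

(** * Bernstein polynomials *)

(** [(bernstein n f).[w]] is the expectation of [f] under the binomial law with
    parameters [n] and [w]: the recursion conditions on the first trial. *)
Fixpoint bernstein (R : realType) (n : nat) (f : nat -> R) : {poly R} :=
  if n is m.+1 then
    'X * bernstein m (fun k => f k.+1) + (1 - 'X) * bernstein m f
  else (f 0%N)%:P.

Lemma bernstein_at0 (R : realType) n (f : nat -> R) :
  (bernstein n f).[0] = f 0%N.
Proof. by elim: n f => [|n IH] f /=; rewrite !hornerE// !IH; ring. Qed.

Lemma bernstein_at1 (R : realType) n (f : nat -> R) :
  (bernstein n f).[1] = f n.
Proof. by elim: n f => [|n IH] f /=; rewrite !hornerE// !IH; ring. Qed.

Lemma bernsteinB (R : realType) n (f g : nat -> R) :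
  bernstein n (fun k => f k - g k) = bernstein n f - bernstein n g.
Proof.
elim: n f g => [|n IH] f g /=; first by rewrite polyCB.
by rewrite !IH; ring.
Qed.

Lemma bernsteinZ (R : realType) n c (f : nat -> R) :
  bernstein n (fun k => c * f k) = c *: bernstein n f.
Proof.
elim: n f => [|n IH] f /=; first by rewrite polyCM mul_polyC.
by rewrite !IH scalerDr !scalerAr.
Qed.

Lemma bernstein1 (R : realType) n : bernstein n (fun=> 1 : R) = 1.
Proof. by elim: n => [|n IH] //=; rewrite !IH; ring. Qed.

(** This turns a formula for the mean of a derivative into the exact mean of
    any Bernstein polynomial, by summing the values of its sequence. *)
Lemma deriv_bernstein (R : realType) n (f : nat -> R) :
  (bernstein n.+1 f)^`() =
  n.+1%:R *: bernstein n (fun k => f k.+1 - f k).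
Proof.
elim: n f => [|n IH] f.
  by rewrite /= !(derivD, derivM, derivX, derivN, derivC) polyCB scale1r; ring.
have bS m (g : nat -> R) : bernstein m.+1 g =
    'X * bernstein m (fun k => g k.+1) + (1 - 'X) * bernstein m g by [].
rewrite bS derivD !derivM derivX derivB derivX derivC !IH.
rewrite !bernsteinB !bS -!mul_polyC !polyC_natr.
rewrite -[n.+2%:R]natr1.
ring.
Qed.

Lemma bernstein_le (R : realType) n (f g : nat -> R) w :
  0 <= w <= 1 -> (forall k, f k <= g k) ->
  (bernstein n f).[w] <= (bernstein n g).[w].
Proof.
move=> /andP[w0 w1]; elim: n f g => [|n IH] f g fg /=; rewrite !hornerE//.
by apply: lerD; apply: ler_wpM2l; rewrite ?subr_ge0//; apply: IH => k.
Qed.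

(** The variance of the binomial law; the shift [s] makes the induction on [n]
    go through, since the first trial moves the centre by [1 - w] or [- w]. *)
Lemma bernstein_variance (R : realType) n (s w : R) :
  (bernstein n (fun k => (k%:R + s - n%:R * w) ^+ 2)).[w] =
  n%:R * (w * (1 - w)) + s ^+ 2.
Proof.
elim: n s => [|n IH] s /=;
  rewrite !(hornerD, hornerM, hornerN, hornerC, hornerX); first by ring.
have -> : (fun k => (k.+1%:R + s - n.+1%:R * w) ^+ 2) =
          (fun k => (k%:R + (s + 1 - w) - n%:R * w) ^+ 2).
  by apply/funext => k; rewrite -!natr1; ring.
have -> : (fun k => (k%:R + s - n.+1%:R * w) ^+ 2) =
          (fun k => (k%:R + (s - w) - n%:R * w) ^+ 2).
  by apply/funext => k; rewrite -!natr1; ring.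
by rewrite !IH -[n.+1%:R]natr1; ring.
Qed.

(** Chebyshev's inequality: when [w] exceeds [m / n] by [d], the binomial
    variable falls below [m] with probability at most its variance,
    [n w (1 - w) <= n], over [(n d)^2]. *)
Lemma bernstein_step_lower (R : realType) n m (d w : R) :
  (0 < n)%N -> 0 < d -> 0 <= w <= 1 -> m%:R / n%:R + d <= w ->
  1 - (n%:R * d ^+ 2)^-1 <= (bernstein n (fun k => (m <= k)%N%:R)).[w].
Proof.
move=> n0 d0 w01 mw.
have n0' : 0 < n%:R :> R by rewrite ltr0n.
rewrite lerBlDl -lerBlDr.
pose c := ((n%:R * d) ^+ 2)^-1.
have c0 : 0 < c by rewrite invr_gt0 exprn_gt0// mulr_gt0.
have -> : 1 - (bernstein n (fun k => (m <= k)%N%:R)).[w] =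
   (bernstein n (fun k => 1 - (m <= k)%N%:R)).[w].
  by rewrite bernsteinB bernstein1 !hornerE.
apply: (@le_trans _ _
    (bernstein n (fun k => c * (k%:R + 0 - n%:R * w) ^+ 2)).[w]).
  apply: bernstein_le => // k; case: leqP => km.
    by rewrite subrr mulr_ge0 ?sqr_ge0 ?ltW.
  rewrite subr0 /c mulrC ler_pdivlMr ?exprn_gt0 ?mulr_gt0// mul1r.
  have kmR : k%:R <= m%:R :> R by rewrite ler_nat ltnW.
  have : n%:R * (m%:R / n%:R + d) <= n%:R * w by rewrite ler_wpM2l// ltW.
  rewrite mulrDr mulrCA mulfV ?gt_eqF// mulr1 => ndw.
  have nd0 : 0 < n%:R * d by rewrite mulr_gt0.
  rewrite -[leRHS]sqrrN; apply: lerXn2r; rewrite ?nnegrE; lra.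
rewrite bernsteinZ hornerZ bernstein_variance.
have -> : (n%:R * d ^+ 2)^-1 = c * n%:R :> R.
  by rewrite /c; field; rewrite !gt_eqF.
apply: ler_wpM2l; first exact: ltW.
rewrite expr0n addr0 ger_pMr//.
case/andP: w01 => w0 w1; nra.
Qed.

(** * Means of bounded measurable functions *)

Definition bounded_mfun (R : realType) d (T : measurableType d) (f : T -> R) :=
  measurable_fun [set: T] f /\ exists M, forall x, `|f x| <= M.

Section bounded.
Context (R : realType) (d : measure_display) (T : measurableType d).
Implicit Types (f g : T -> R).

Lemma bounded_mfun_cst c : bounded_mfun (fun _ : T => c : R).
Proof. by split; [exact: measurable_cst | exists `|c|]. Qed.

Lemma bounded_mfunD f g :
  bounded_mfun f -> bounded_mfun g -> bounded_mfun (fun x => f x + g x).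
Proof.
move=> [mf [M fM]] [mg [N gN]]; split; first exact: measurable_funD.
by exists (M + N) => x; rewrite (le_trans (ler_normD _ _))// lerD.
Qed.

Lemma bounded_mfunM f g :
  bounded_mfun f -> bounded_mfun g -> bounded_mfun (fun x => f x * g x).
Proof.
move=> [mf [M fM]] [mg [N gN]]; split; first exact: measurable_funM.
by exists (M * N) => x; rewrite normrM ler_pM.
Qed.

Lemma bounded_mfunX f n : bounded_mfun f -> bounded_mfun (fun x => f x ^+ n).
Proof.
move=> bf; elim: n => [|n IH]; first exact: bounded_mfun_cst.
by under eq_fun do rewrite exprS; exact: bounded_mfunM.
Qed.

Lemma bounded_mfun_sum I (s : seq I) (F : I -> T -> R) :
  (forall i, bounded_mfun (F i)) -> bounded_mfun (fun x => \sum_(i <- s) F i x).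
Proof.
move=> bF; elim: s => [|i s IH].
  by under eq_fun do rewrite big_nil; exact: bounded_mfun_cst.
by under eq_fun do rewrite big_cons; exact: bounded_mfunD.
Qed.

Lemma bounded_mfun_horner f (p : {poly R}) :
  bounded_mfun f -> bounded_mfun (fun x => p.[f x]).
Proof.
move=> bf; under eq_fun do rewrite horner_coef.
apply: bounded_mfun_sum => i; apply: bounded_mfunM.
  exact: bounded_mfun_cst.
exact: bounded_mfunX.
Qed.

Variable P : probability T R.

Lemma bounded_mfun_integrable f :
  bounded_mfun f -> P.-integrable [set: T] (EFin \o f).
Proof.
move=> [mf [M fM]]; apply: measurable_bounded_integrable => //.
  by rewrite ltey_eq fin_num_measure.
exists M; split; rewrite ?num_real// => y My x _.
exact: le_trans (fM x) (ltW My).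
Qed.

Lemma mean_cst (c : R) : \int[P]_x c = c.
Proof.
rewrite Rintegral_cst//.
by have /= -> := probability_setT P; rewrite mulr1.
Qed.

Lemma meanD f g : bounded_mfun f -> bounded_mfun g ->
  \int[P]_x (f x + g x) = \int[P]_x f x + \int[P]_x g x.
Proof.
by move=> bf bg; rewrite RintegralD//; apply: bounded_mfun_integrable.
Qed.

Lemma meanZ c f : bounded_mfun f ->
  \int[P]_x (c * f x) = c * \int[P]_x f x.
Proof. by move=> bf; rewrite RintegralZl//; apply: bounded_mfun_integrable. Qed.

Lemma mean_sum I (s : seq I) (F : I -> T -> R) :
  (forall i, bounded_mfun (F i)) ->
  \int[P]_x (\sum_(i <- s) F i x) = \sum_(i <- s) \int[P]_x F i x.
Proof.
move=> bF; elim: s => [|i s IH].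
  by under eq_fun do rewrite big_nil; rewrite mean_cst big_nil.
under eq_fun do rewrite big_cons.
by rewrite meanD ?IH ?big_cons//; exact: bounded_mfun_sum.
Qed.

Lemma mean_le f g : bounded_mfun f -> bounded_mfun g ->
  (forall x, f x <= g x) -> \int[P]_x f x <= \int[P]_x g x.
Proof.
by move=> bf bg fg; apply: le_Rintegral => //; apply: bounded_mfun_integrable.
Qed.

Lemma bounded_mfun_indic (A : set T) :
  measurable A -> bounded_mfun (\1_A : T -> R).
Proof.
move=> mA; split; first exact: measurable_indic.
by exists 1 => x; rewrite indicE; case: (x \in A); rewrite ?normr1 ?normr0.
Qed.

Lemma mean_indic (A : set T) : measurable A -> \int[P]_x (\1_A x) = fine (P A).
Proof. by move=> mA; rewrite /Rintegral integral_indic// setIT. Qed.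

End bounded.

Lemma measurable_superlevel (R : realType) d (T : measurableType d)
    (f : T -> R) a :
  measurable_fun [set: T] f -> measurable [set x | a < f x].
Proof.
move=> mf; rewrite (_ : [set x | _] = f @^-1` `]a, +oo[); last first.
  by apply/seteqP; split => x /=; rewrite in_itv/= andbT.
by rewrite -[X in measurable X]setTI; apply: mf => //; exact: measurable_itv.
Qed.

(** * Moments determine the uniform law *)

Section uniform_moments.
Context (R : realType) (d : measure_display) (T : measurableType d).
Variables (P : probability T R) (W : T -> R).
Hypotheses (mW : measurable_fun [set: T] W) (W01 : forall x, 0 <= W x <= 1).
Hypothesis W_moments :
  forall q : {poly R}, \int[P]_x (q^`()).[W x] = q.[1] - q.[0].

Let bW : bounded_mfun W.
Proof.
split=> //; exists 1 => x; have /andP[w0 w1] := W01 x.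
by rewrite ger0_norm.
Qed.

Let measurable_tail a : measurable [set x | a < W x].
Proof. exact: measurable_superlevel. Qed.

(** The step is the difference sequence of the truncated subtraction
    [k |-> k - m], whose Bernstein polynomial takes the values [0] and
    [n + 1 - m] at the endpoints. *)
Lemma mean_bernstein_step n m : (m <= n.+1)%N ->
  \int[P]_x (bernstein n (fun k => (m <= k)%N%:R)).[W x] =
  (n.+1%:R - m%:R) / n.+1%:R.
Proof.
move=> mn; pose f k : R := (k - m)%N%:R.
have step : (fun k => (m <= k)%N%:R) = (fun k => f k.+1 - f k).
  apply/funext => k; rewrite /f; case: leqP => km.
    by rewrite subSn// -natr1 addrAC subrr add0r.
  by rewrite (eqP km) (eqP (ltnW km)) subrr.
have := W_moments (bernstein n.+1 f).
rewrite deriv_bernstein -step bernstein_at1 bernstein_at0.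
under eq_Rintegral do rewrite hornerZ.
rewrite meanZ; last exact: bounded_mfun_horner.
move=> h; apply: (@mulfI _ n.+1%:R); first by rewrite pnatr_eq0.
by rewrite h /f sub0n subr0 natrB// mulrC divfK// pnatr_eq0.
Qed.

Lemma uniform_tail_approx n m (e : R) : (0 < n)%N -> (m <= n)%N -> 0 < e ->
  fine (P [set x | m%:R / n%:R + e < W x]) <=
  (n.+1%:R - m%:R) / n.+1%:R + (n%:R * e ^+ 2)^-1.
Proof.
move=> n0 mn e0; rewrite -mean_indic//.
rewrite -mean_bernstein_step; last exact: leq_trans mn _.
rewrite -[X in _ <= _ + X](mean_cst P).
have bB := bounded_mfun_horner (bernstein n (fun k => (m <= k)%N%:R)) bW.
rewrite -meanD//; last exact: bounded_mfun_cst.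
apply: mean_le.
- exact: bounded_mfun_indic.
- by apply: bounded_mfunD => //; exact: bounded_mfun_cst.
move=> x; rewrite indicE; have [Wx|_] := boolP (x \in _).
  rewrite inE /= in Wx.
  by rewrite -lerBlDr; apply: bernstein_step_lower => //; exact: ltW.
apply: addr_ge0; last by rewrite invr_ge0 mulr_ge0 ?sqr_ge0.
have <- : (bernstein n (fun=> 0 : R)).[W x] = 0.
  have := bernsteinZ n 0 (fun=> 1 : R).
  rewrite scale0r; under [X in bernstein n X]eq_fun do rewrite mul0r.
  by move=> ->; rewrite horner0.
by apply: bernstein_le => // k; rewrite ler0n.
Qed.

(** The thresholds [m / n], with [m] the integer part of [n b], approach [b]
    from below as [n] grows, and a level [b + e] with [e > 0] leaves room for
    Chebyshev's inequality.  The level [a] itself is reached by letting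
    [b = a - e] tend to [a]. *)
Lemma uniform_tail_le (a : R) :
  0 <= a <= 1 -> fine (P [set x | a < W x]) <= 1 - a.
Proof.
move=> /andP[a0 a1].
have shift (b e : R) :
    0 <= b <= 1 -> 0 < e -> fine (P [set x | b + e < W x]) <= 1 - b.
  move=> /andP[b0 b1] e0; rewrite leNgt; apply/negP.
  set p := fine _ => pb.
  (* The errors of the approximation add up to at most [C / n]. *)
  pose C : R := 2 + (e ^+ 2)^-1.
  have C0 : 0 < C by rewrite addr_gt0 ?invr_gt0 ?exprn_gt0.
  have p0 : 0 < p - (1 - b) by rewrite subr_gt0.
  have [n Cn] : exists n : nat, C / (p - (1 - b)) < n%:R.
    by exists (Num.bound (C / (p - (1 - b)))); apply: archi_boundP;
      rewrite divr_ge0 ?ltW.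
  have nR0 : 0 < n%:R :> R by apply: lt_trans Cn; exact: divr_gt0.
  have n0 : (0 < n)%N by rewrite ltr0n in nR0.
  pose m := Num.truncn (n%:R * b).
  have /andP[m1 m2] : m%:R <= n%:R * b < m.+1%:R.
    by rewrite /m; apply: truncn_itv; rewrite mulr_ge0 ?ler0n.
  have mn : (m <= n)%N.
    by rewrite -(ler_nat R); apply: le_trans m1 _; rewrite ger_pMr.
  have := uniform_tail_approx n0 mn e0.
  set q := fine _ => hq.
  have pq : p <= q.
    rewrite /p /q fine_le ?fin_num_measure//.
    apply: le_measure; rewrite ?inE//.
    move=> x /=; apply: le_lt_trans; rewrite lerD2r ler_pdivrMr// mulrC//.
  have : (n.+1%:R - m%:R) / n.+1%:R <= 1 - b + 2 / n%:R.
    rewrite ler_pdivrMr ?ltr0n// -[n.+1%:R]natr1.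
    rewrite -[m.+1%:R]natr1 in m2.
    have h2 : 2 / n%:R * n%:R = 2 :> R by rewrite divfK ?gt_eqF.
    have h3 : 0 <= 2 / n%:R :> R by rewrite divr_ge0 ?ltW.
    rewrite mulrDl [2 / _ * _]mulrDr h2; nra.
  have : 2 / n%:R + (n%:R * e ^+ 2)^-1 = C / n%:R.
    by rewrite /C; field; rewrite !gt_eqF// exprn_gt0.
  have {}Cn : C / n%:R < p - (1 - b).
    by move: Cn; rewrite !ltr_pdivrMr// mulrC.
  move=> eqC le1; rewrite -{}eqC in Cn; have := le_trans pq hq; move: Cn le1.
  have tr (x y z : R) :
      x + z < p - (1 - b) -> y <= 1 - b + x -> p <= y + z -> False.
    by clearbody p; lra.
  exact: tr.
have [->|an0] := eqVneq a 0.
  by rewrite subr0 -lee_fin fineK ?fin_num_measure// probability_le1.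
apply/ler_addgt0Pr => e e0.
pose e' := Num.min e a.
have e'0 : 0 < e' by rewrite lt_min e0 lt0r an0.
have e'a : e' <= a by rewrite ge_min lexx orbT.
have e'e : e' <= e by rewrite ge_min lexx.
have := @shift (a - e') e' _ e'0; rewrite subrK => h.
apply: le_trans (h _) _; last by lra.
by rewrite subr_ge0 e'a/=; lra.
Qed.

End uniform_moments.

(** The hypothesis says that [W] has the moments [1 / (k + 1)] of the uniform
    law on [0, 1].  It is preserved when [W] is replaced by [1 - W], so the
    upper bound on tails also yields the lower bound. *)
Lemma uniform_tail (R : realType) (d : measure_display) (T : measurableType d)
    (P : probability T R) (W : T -> R) (a : R) :
  measurable_fun [set: T] W -> (forall x, 0 <= W x <= 1) ->
  (forall q : {poly R}, \int[P]_x (q^`()).[W x] = q.[1] - q.[0]) ->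
  0 <= a <= 1 -> P [set x | a < W x] = (1 - a)%:E.
Proof.
move=> mW W01 hW a01.
have Pfin A : measurable A -> P A \is a fin_num.
  by move=> mA; rewrite fin_num_measure.
apply/eqP; rewrite -(fineK (Pfin _ (measurable_superlevel a mW))) eqe eq_le.
rewrite uniform_tail_le//=.
have mV : measurable_fun [set: T] (fun x => 1 - W x).
  by apply: measurable_funB => //; exact: measurable_cst.
have V01 x : 0 <= 1 - W x <= 1 by have := W01 x; lra.
have hV (q : {poly R}) : \int[P]_x (q^`()).[1 - W x] = q.[1] - q.[0].
  have := hW (- (q \Po (1 - 'X))).
  rewrite derivN deriv_comp derivB derivX derivC sub0r mulrN1 opprK.
  have -> : (- (q \Po (1 - 'X))).[1] = - q.[0].
    by rewrite hornerN horner_comp !hornerE subrr.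
  have -> : (- (q \Po (1 - 'X))).[0] = - q.[1].
    by rewrite hornerN horner_comp !hornerE subr0.
  rewrite opprK => h; rewrite [RHS]addrC -h.
  by apply: eq_Rintegral => x _; rewrite horner_comp !hornerE.
apply/ler_addgt0Pr => e e0.
have [ae|ae] := lerP 1 (a + e).
  have : 0 <= fine (P [set x | a < W x]) by rewrite fine_ge0.
  lra.
have := @uniform_tail_le _ _ _ P _ mV V01 hV (1 - (a + e)).
have -> : [set x | 1 - (a + e) < 1 - W x] = ~` [set x | a + e <= W x].
  apply/seteqP; split => x /=; rewrite ltrD2l ltrN2 real_ltNge ?num_real//;
    by move/negP.
have mle : measurable [set x | a + e <= W x].
  rewrite (_ : [set x | _] = W @^-1` `[a + e, +oo[); last first.
    by apply/seteqP; split => x /=; rewrite in_itv/= andbT.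
  by rewrite -[X in measurable X]setTI; apply: mW => //; exact: measurable_itv.
rewrite probability_setC// fineB ?Pfin//= => h.
have /h : 0 <= 1 - (a + e) <= 1 by case/andP: a01 => a0 _; apply/andP; lra.
have : fine (P [set x | a + e <= W x]) <= fine (P [set x | a < W x]).
  apply: fine_le; rewrite ?Pfin//; first exact: measurable_superlevel.
  apply: le_measure; rewrite ?inE//; first exact: measurable_superlevel.
  by move=> x /=; apply: lt_le_trans; rewrite ltrDl.
move: (fine _) (fine _) => y z; lra.
Qed.

(** * Rotations and the Euclidean inner product *)

Section dot.
Context (R : realType).

Lemma dotE n (u v : 'cV[R]_n) : dot u v = (u^T *m v) ord0 ord0.
Proof. by rewrite mxE; apply: eq_bigr => i _; rewrite mxE. Qed.

Lemma dotC n (u v : 'cV[R]_n) : dot u v = dot v u.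
Proof. by apply: eq_bigr => i _; rewrite mulrC. Qed.

Lemma dotDl n (u v w : 'cV[R]_n) : dot (u + v) w = dot u w + dot v w.
Proof.
by rewrite /dot -big_split; apply: eq_bigr => i _; rewrite mxE mulrDl.
Qed.

Lemma dotZl n c (u v : 'cV[R]_n) : dot (c *: u) v = c * dot u v.
Proof. by rewrite /dot mulr_sumr; apply: eq_bigr => i _; rewrite mxE mulrA. Qed.

Lemma dotDr n (u v w : 'cV[R]_n) : dot w (u + v) = dot w u + dot w v.
Proof. by rewrite dotC dotDl !(dotC w). Qed.

Lemma dotZr n c (u v : 'cV[R]_n) : dot u (c *: v) = c * dot u v.
Proof. by rewrite dotC dotZl dotC. Qed.

Lemma dot_mulmx n (A : 'M[R]_n) u v : dot (A *m u) v = dot u (A^T *m v).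
Proof. by rewrite !dotE trmx_mul mulmxA. Qed.

Lemma dot_ge0 n (u : 'cV[R]_n) : 0 <= dot u u.
Proof. by apply: sumr_ge0 => i _; rewrite -expr2 sqr_ge0. Qed.

Lemma dot_eq0 n (u : 'cV[R]_n) : dot u u = 0 -> u = 0.
Proof.
move=> /eqP; rewrite psumr_eq0; last by move=> i _; rewrite -expr2 sqr_ge0.
move=> /allP u0; apply/colP => i; rewrite mxE.
by have := u0 i (mem_index_enum i); rewrite mulf_eq0 orbb => /eqP.
Qed.

Lemma unit_vectorE n (u : 'cV[R]_n) : unit_vector u <-> dot u u = 1.
Proof.
rewrite /unit_vector /euclidean_norm; split=> [u1|->]; last by rewrite sqrtr1.
by rewrite -(sqr_sqrtr (dot_ge0 u)) u1 expr1n.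
Qed.

Lemma dot_itv n (u v : 'cV[R]_n) :
  dot u u = 1 -> dot v v = 1 -> -1 <= dot u v <= 1.
Proof.
move=> u1 v1.
have := dot_ge0 (u + v); have := dot_ge0 (u + (-1) *: v).
rewrite !(dotDl, dotDr, dotZl, dotZr) u1 v1 (dotC v u) => h1 h2.
by apply/andP; lra.
Qed.

Lemma mulmx_dot n (u v w : 'cV[R]_n) : u *m v^T *m w = dot v w *: u.
Proof.
by rewrite -mulmxA; apply/colP => i; rewrite !mxE big_ord1 -dotE mulrC.
Qed.

Lemma unit_vector_normalize n (u : 'cV[R]_n) : u != 0 ->
  exists2 s, 0 < s & dot (s^-1 *: u) (s^-1 *: u) = 1 /\ s ^+ 2 = dot u u.
Proof.
move=> u0; exists (Num.sqrt (dot u u)).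
  rewrite sqrtr_gt0 lt_neqAle dot_ge0 andbT eq_sym.
  by apply/eqP => /dot_eq0 /eqP; apply/negP.
rewrite sqr_sqrtr ?dot_ge0//; split => //.
rewrite dotZl dotZr mulrA -expr2 exprVn sqr_sqrtr ?dot_ge0// mulVf//.
by apply/eqP => /dot_eq0 /eqP; apply/negP.
Qed.

End dot.

Section half_turn.
Context (R : realType).

(** The rotation by [pi] around the axis [m], when [m] is a unit vector. *)
Definition half_turn_mx (m : 'cV[R]_3) : 'M[R]_3 := 2 *: (m *m m^T) - 1%:M.

Lemma half_turn_apply m v : half_turn_mx m *m v = (2 * dot m v) *: m - v.
Proof. by rewrite mulmxBl -scalemxAl mulmx_dot scalerA mul1mx. Qed.

Lemma half_turn_SO3 m : dot m m = 1 ->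
  (half_turn_mx m *m (half_turn_mx m)^T == 1%:M) &&
  (\det (half_turn_mx m) == 1).
Proof.
move=> m1; apply/andP; split; apply/eqP.
  have -> : (half_turn_mx m)^T = half_turn_mx m.
    by rewrite /half_turn_mx linearB linearZ /= trmx_mul trmxK trmx1.
  rewrite {2}/half_turn_mx mulmxBr mulmx1 -scalemxAr mulmxA half_turn_apply m1.
  rewrite mulr1 mulmxBl -scalemxAl /half_turn_mx.
  apply/matrixP => i j; rewrite !mxE; ring.
(* Naming the coordinates by natural numbers merges the various forms in
   which the Laplace expansion presents the same index. *)
pose c k := m (inord k) ord0.
have mE i : m i ord0 = c i by rewrite /c inord_val.
rewrite (expand_det_row _ ord0) !big_ord_recl big_ord0 /cofactor.
rewrite !(expand_det_row _ ord0) !big_ord_recl !big_ord0 /cofactor !det_mx11.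
rewrite !mxE !big_ord1 !mxE /= !mE /= /bump /=.
transitivity (2 * dot m m - 1); last by rewrite m1; ring.
by rewrite /dot !big_ord_recl big_ord0 !mE /= /bump /=; ring.
Qed.

Definition half_turn m (m1 : dot m m = 1) : SO3 R := MkSO3 (half_turn_SO3 m1).

End half_turn.

Section transitivity.
Context (R : realType).

Definition vec3 (a b c : R) : 'cV[R]_3 := \col_(i < 3) [:: a; b; c]`_i.

Lemma dot3E (u v : 'cV[R]_3) :
  dot u v = u 0 ord0 * v 0 ord0 + u 1 ord0 * v 1 ord0 + u 2 ord0 * v 2 ord0.
Proof.
rewrite /dot !big_ord_recl big_ord0 addr0 addrA.
by do ![congr (_ + _)]; congr (_ * _); congr fun_of_matrix; apply: val_inj.
Qed.

Lemma dot_vec3 a b c (v : 'cV[R]_3) :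
  dot (vec3 a b c) v = a * v 0 ord0 + b * v 1 ord0 + c * v 2 ord0.
Proof. by rewrite dot3E !mxE. Qed.

Lemma orthogonal_unit_vector (v : 'cV[R]_3) :
  exists2 m, dot m m = 1 & dot m v = 0.
Proof.
have [p p0 pv] : exists2 p, p != 0 & dot p v = 0.
  have [v0|v0] := eqVneq (v 0 ord0) 0.
    exists (vec3 1 0 0); last by rewrite dot_vec3 v0; ring.
    by apply/eqP => /colP /(_ 0); rewrite !mxE /= => /eqP; rewrite oner_eq0.
  exists (vec3 (- v 1 ord0) (v 0 ord0) 0); last by rewrite dot_vec3; ring.
  by apply/eqP => /colP /(_ 1); rewrite !mxE /=; exact/eqP.
have [s s0 [ps _]] := unit_vector_normalize p0.
by exists (s^-1 *: p); rewrite // dotZl pv mulr0.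
Qed.

(** A half-turn around the bisector of [v] and [w] exchanges them; when
    [w = - v], any axis orthogonal to [v] will do. *)
Lemma SO3_transitive (v w : 'cV[R]_3) : dot v v = 1 -> dot w w = 1 ->
  exists g : SO3 R, SO3_mx g *m v = w.
Proof.
move=> v1 w1; have [vw|vw] := eqVneq (v + w) 0.
  have [m m1 mv] := orthogonal_unit_vector v.
  exists (half_turn m1); rewrite /= half_turn_apply mv mulr0 scale0r sub0r.
  by apply/eqP; rewrite eq_sym -addr_eq0 addrC vw.
have [s s0 [m1 s2]] := unit_vector_normalize vw.
exists (half_turn m1); rewrite /= half_turn_apply dotZl scalerA.
have -> : 2 * (s^-1 * dot (v + w) v) * s^-1 = 1.
  have : s ^+ 2 != 0 by rewrite expf_neq0 ?gt_eqF.
  move=> sn0; apply: (mulfI sn0); rewrite mulr1 {2}s2.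
  rewrite !(dotDl, dotDr) v1 w1 (dotC w v).
  by field; rewrite gt_eqF.
by rewrite scale1r addrAC subrr add0r.
Qed.

Lemma SO3_dot (g : SO3 R) (v w : 'cV[R]_3) :
  dot (SO3_mx g *m v) (SO3_mx g *m w) = dot v w.
Proof.
have /andP[/eqP /mulmx1C gO _] := SO3P g.
by rewrite dot_mulmx mulmxA gO mul1mx.
Qed.

End transitivity.

(** * The law of the coordinates of a random rotation of a vector *)

Section Haar_law.
Context (R : realType) (mu : probability (SO3 R) R).
Hypothesis mu_Haar : normalized_Haar mu.
Variables (u : 'cV[R]_3) (u1 : dot u u = 1).

Lemma measurable_SO3_entry i j :
  measurable_fun [set: SO3 R] (fun g : SO3 R => SO3_mx g i j).
Proof.
apply: (measurability _ (RGenOpens.measurableE R)) => _ [_ [a [b ->]] <-].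
rewrite setTI; apply: sub_sigma_algebra.
have cont : continuous (fun g : SO3 R => SO3_mx g i j).
  move=> g.
  apply: (@continuous_comp _ _ _ (@SO3_mx R) (fun M : 'M[R]_3 => M i j)).
    exact: (@initial_continuous _ _ (@SO3_mx R)).
  exact: coord_continuous.
move/continuousP : cont; apply; exact: itv_open.
Qed.

Lemma measurable_SO3_dot (w : 'cV[R]_3) :
  measurable_fun [set: SO3 R] (fun g : SO3 R => dot w (SO3_mx g *m u)).
Proof.
apply: measurable_sum => i; apply: measurable_funM; first exact: measurable_cst.
under eq_fun do rewrite mxE.
apply: measurable_sum => j; apply: measurable_funM; last exact: measurable_cst.
exact: measurable_SO3_entry.
Qed.

Lemma bounded_SO3_dot (w : 'cV[R]_3) : dot w w = 1 ->
  bounded_mfun (fun g : SO3 R => dot w (SO3_mx g *m u)).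
Proof.
move=> w1; split; first exact: measurable_SO3_dot.
by exists 1 => g; rewrite ler_norml dot_itv// SO3_dot.
Qed.

(** If [h v = w] then left translation by [h] carries the event on the
    coordinate along [v] to the same event on the coordinate along [w]. *)
Lemma Haar_law (v w : 'cV[R]_3) (B : set R) : dot v v = 1 -> dot w w = 1 ->
  measurable B ->
  mu [set g | B (dot v (SO3_mx g *m u))] =
  mu [set g | B (dot w (SO3_mx g *m u))].
Proof.
move=> v1 w1 mB; have [h hv] := SO3_transitive v1 w1.
rewrite -(mu_Haar h); last first.
  rewrite -[X in measurable X]setTI.
  exact: (measurable_SO3_dot v).
congr (mu _); apply/seteqP; split => [_ [g /= Bg <-]|g /= Bg].
  by rewrite /= -hv -mulmxA SO3_dot.
exists (h^-1 * g)%g; last by rewrite mulVKg.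
rewrite /= -(SO3_dot h) hv mulmxA (_ : SO3_mx h *m _ = SO3_mx g)//.
by rewrite -[LHS]/(SO3_mx (h * (h^-1 * g))%g) mulVKg.
Qed.

Lemma Haar_mean (v w : 'cV[R]_3) (p : {poly R}) : dot v v = 1 -> dot w w = 1 ->
  \int[mu]_g p.[dot v (SO3_mx g *m u)] =
  \int[mu]_g p.[dot w (SO3_mx g *m u)].
Proof.
move=> v1 w1; congr fine.
have push (x : 'cV[R]_3) : dot x x = 1 ->
    (\int[mu]_g (p.[dot x (SO3_mx g *m u)])%:E =
     \int[pushforward mu (fun g : SO3 R => dot x (SO3_mx g *m u))]_y
       (p.[y])%:E)%E.
  move=> x1; rewrite integral_pushforward//.
  - exact: measurable_SO3_dot.
  - by apply/measurable_EFinP; exact: measurable_poly.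
  - rewrite preimage_setT.
    apply: (@bounded_mfun_integrable _ _ _ _
      (fun g => p.[dot x (SO3_mx g *m u)])).
    exact/bounded_mfun_horner/bounded_SO3_dot.
rewrite !push//; apply: eq_measure_integral;
  [exact: measurable_SO3_dot..|move=> ? ? B mB _].
exact: Haar_law.
Qed.
End Haar_law.

(** * The moments of a coordinate *)

Lemma poly_ext (R : numDomainType) (p q : {poly R}) :
  (forall a, p.[a] = q.[a]) -> p = q.
Proof.
move=> pq; apply/eqP; rewrite -subr_eq0; apply/negP => /negP pq0.
pose s : seq R := [seq i%:R | i <- iota 0 (size (p - q))].
have := @max_poly_roots _ _ s pq0; rewrite size_map size_iota ltnn => h.
suff : false by []. apply: h.
  by apply/allP => a _; rewrite /root hornerD hornerN pq subrr.
by rewrite map_inj_uniq ?iota_uniq//; apply: mulrIn; rewrite oner_eq0.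
Qed.

Lemma coef2_exp (R : comNzRingType) k : ((1 + 'X^2 : {poly R}) ^+ k)`_2 = k%:R.
Proof.
suff [] : ((1 + 'X^2 : {poly R}) ^+ k)`_0 = 1 /\
  ((1 + 'X^2 : {poly R}) ^+ k)`_2 = k%:R by [].
elim: k => [|k [IH0 IH2]]; first by rewrite expr0 !coefC.
rewrite exprSr mulrDr mulr1 !coefD !coefMXn /= subnn IH0 IH2 addr0.
by rewrite natr1.
Qed.

Section moments.
Context (R : realType) (mu : probability (SO3 R) R).
Hypothesis mu_Haar : normalized_Haar mu.
Variables (u : 'cV[R]_3) (u1 : dot u u = 1).

Let c (w : 'cV[R]_3) (g : SO3 R) := dot w (SO3_mx g *m u).

Let bc w : dot w w = 1 -> bounded_mfun (c w).
Proof. exact: bounded_SO3_dot. Qed.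

Lemma moment_eq (v w : 'cV[R]_3) n : dot v v = 1 -> dot w w = 1 ->
  \int[mu]_g c v g ^+ n = \int[mu]_g c w g ^+ n.
Proof.
move=> v1 w1; have := Haar_mean mu_Haar u1 'X^n v1 w1.
by under eq_Rintegral do rewrite hornerXn;
   under [in X in _ = X -> _]eq_Rintegral do rewrite hornerXn.
Qed.

(** The coordinate along [- w] has the same law as the one along [w]. *)
Lemma moment_odd (w : 'cV[R]_3) n : dot w w = 1 -> odd n ->
  \int[mu]_g c w g ^+ n = 0.
Proof.
move=> w1 n_odd.
have Nw1 : dot (-1 *: w) (-1 *: w) = 1 by rewrite dotZl dotZr w1; ring.
have := moment_eq n w1 Nw1.
under [in X in _ = X -> _]eq_Rintegral do
  rewrite /c dotZl exprMn -signr_odd n_odd expr1.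
rewrite meanZ; last exact/bounded_mfunX/bc.
move: (Rintegral _ _ _) => x; lra.
Qed.

(** The coordinate along the unit vector [(f + a e) / s], with
    [s^2 = 1 + a^2], has the same moments as the one along [f].  Expanding its
    power [2k] by the binomial formula gives two polynomials in [a] that agree
    for all [a]; the lemma compares their coefficients of [a^2]. *)
Lemma mixed_moment (e f : 'cV[R]_3) k :
  dot e e = 1 -> dot f f = 1 -> dot e f = 0 ->
  'C(k.*2, 2)%:R * \int[mu]_g (c f g ^+ (k.*2 - 2) * c e g ^+ 2) =
  k%:R * \int[mu]_g c f g ^+ k.*2.
Proof.
move=> e1 f1 ef0; set m := \int[mu]_g c f g ^+ k.*2.
have bmix i j : bounded_mfun (fun g => c f g ^+ i * c e g ^+ j).
  by apply: bounded_mfunM; apply/bounded_mfunX/bc.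
pose p : {poly R} := \poly_(j < k.*2.+1)
  ('C(k.*2, j)%:R * \int[mu]_g (c f g ^+ (k.*2 - j) * c e g ^+ j)).
have pE : p = m *: (1 + 'X^2) ^+ k.
  apply: poly_ext => a; rewrite horner_poly.
  have [s s0 s2] : exists2 s : R, 0 < s & s ^+ 2 = 1 + a ^+ 2.
    exists (Num.sqrt (1 + a ^+ 2)); last first.
      by rewrite sqr_sqrtr// addr_ge0 ?sqr_ge0.
    by rewrite sqrtr_gt0 ltr_pwDl// sqr_ge0.
  pose w := s^-1 *: (f + a *: e).
  have w1 : dot w w = 1.
    transitivity ((s ^+ 2)^-1 * (1 + a ^+ 2)).
      rewrite !(dotZl, dotZr, dotDl, dotDr) e1 f1 (dotC f e) ef0.
      by field; rewrite gt_eqF.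
    by rewrite s2 mulVf// -s2 expf_neq0// gt_eqF.
  have -> : (m *: (1 + 'X^2) ^+ k).[a] = s ^+ k.*2 * \int[mu]_g c w g ^+ k.*2.
    rewrite hornerZ horner_exp hornerD hornerXn hornerC -s2 -exprM mul2n mulrC.
    by rewrite /m (moment_eq _ f1 w1).
  rewrite -meanZ; last exact/bounded_mfunX/bc.
  have expand g : s ^+ k.*2 * c w g ^+ k.*2 = \sum_(j < k.*2.+1)
      ('C(k.*2, j)%:R * a ^+ j) * (c f g ^+ (k.*2 - j) * c e g ^+ j).
    rewrite -exprMn /c dotZl mulrA divff ?gt_eqF// mul1r dotDl dotZl exprDn.
    by apply: eq_bigr => j _; rewrite exprMn -mulr_natl; ring.
  under [RHS]eq_Rintegral do rewrite expand.
  rewrite mean_sum; last first.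
    by move=> j; apply: bounded_mfunM => //; exact: bounded_mfun_cst.
  by apply: eq_bigr => j _; rewrite meanZ// mulrAC.
have := congr1 (fun q : {poly R} => q`_2) pE.
rewrite coefZ coef2_exp coef_poly => coefE; rewrite [RHS]mulrC -{}coefE.
case: k @m p bmix pE => [|k] m p bmix pE //=.
(* For [k = 0] the coefficient is out of range and both sides vanish. *)
by rewrite bin_small// mul0r.
Qed.

(** The squares of the coordinates along three orthogonal axes add up to 1;
    multiplying by [z^(2k)], with [z] the third coordinate, relates the mixed
    moments to two consecutive even moments. *)
Lemma moment_rec k (f : 'cV[R]_3) : dot f f = 1 ->
  k.*2.+3%:R * \int[mu]_g c f g ^+ k.*2.+2 =
  k.*2.+1%:R * \int[mu]_g c f g ^+ k.*2.
Proof.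
move=> f1.
have d x y z x' y' z' :
    dot (vec3 x y z) (vec3 x' y' z') = x * x' + y * y' + z * z' :> R.
  by rewrite dot_vec3 !mxE.
pose e0 := vec3 1 0 0 : 'cV[R]_3; pose e1 := vec3 0 1 0 : 'cV[R]_3.
pose e2 := vec3 0 0 1 : 'cV[R]_3.
have n0 : dot e0 e0 = 1 by rewrite d; ring.
have n1 : dot e1 e1 = 1 by rewrite d; ring.
have n2 : dot e2 e2 = 1 by rewrite d; ring.
rewrite !(moment_eq _ f1 n2).
have h0 := @mixed_moment e0 e2 k.+1 n0 n2 ltac:(rewrite d; ring).
have h1 := @mixed_moment e1 e2 k.+1 n1 n2 ltac:(rewrite d; ring).
rewrite doubleS subn2 /= in h0 h1.
have bmix w i j : dot w w = 1 ->
    bounded_mfun (fun g => c e2 g ^+ i * c w g ^+ j).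
  by move=> w1; apply: bounded_mfunM; apply/bounded_mfunX/bc.
have split_sphere : \int[mu]_g c e2 g ^+ k.*2 =
    \int[mu]_g (c e2 g ^+ k.*2 * c e0 g ^+ 2) +
    (\int[mu]_g (c e2 g ^+ k.*2 * c e1 g ^+ 2) +
     \int[mu]_g c e2 g ^+ k.*2.+2).
  have b2 := bounded_mfunX k.*2.+2 (bc n2).
  rewrite -!meanD//; do ?[exact: bmix]; last first.
    by apply: bounded_mfunD => //; exact: bmix.
  apply: eq_Rintegral => g _.
  have : c e0 g ^+ 2 + c e1 g ^+ 2 + c e2 g ^+ 2 = 1.
    have h := SO3_dot g u u; rewrite u1 dot3E in h.
    by rewrite -[RHS]h /c !dot_vec3; ring.
  move=> sum1; rewrite -[k.*2.+2]addn2 exprD; move: (_ ^+ k.*2) => y.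
  by rewrite -[LHS]mulr1 -[in LHS]sum1; ring.
have bin : 'C(k.*2.+2, 2)%:R = k.+1%:R * k.*2.+1%:R :> R.
  by rewrite -[k.*2.+2]/(k.+1.*2) bin2 -doubleMl doubleK natrM.
have kn0 : k.+1%:R != 0 :> R by rewrite pnatr_eq0.
rewrite bin -!mulrA in h0 h1; move/(mulfI kn0) in h0; move/(mulfI kn0) in h1.
rewrite split_sphere !mulrDr h0 h1 -[k.*2.+3]addn2 natrD mulrDl; ring.
Qed.

Lemma moment_value n (f : 'cV[R]_3) : dot f f = 1 ->
  n.+1%:R * \int[mu]_g c f g ^+ n = (1 - (-1) ^+ n.+1) / 2.
Proof.
move=> f1; rewrite -signr_odd /=; have [n_odd|n_even] := boolP (odd n).
  by rewrite moment_odd// mulr0 subrr mul0r.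
rewrite expr1 -(odd_double_half n) (negbTE n_even) add0n.
elim: n./2 => [|k IH]; last by rewrite doubleS moment_rec.
under eq_Rintegral do rewrite expr0.
by rewrite mean_cst double0 mulr1 opprK divff.
Qed.

(** Both sides are linear in [q], so this only restates the values of the
    moments: the coordinate is uniform on [-1, 1] as far as polynomials can
    tell. *)
Lemma mean_deriv (q : {poly R}) (f : 'cV[R]_3) : dot f f = 1 ->
  \int[mu]_g (q^`()).[c f g] = (q.[1] - q.[-1]) / 2.
Proof.
move=> f1.
have bq (p : {poly R}) := bounded_mfun_horner p (bc f1).
rewrite -[q]coefK poly_def linear_sum /= !horner_sum.
under eq_Rintegral do rewrite horner_sum.
rewrite mean_sum// -sumrB mulr_suml; apply: eq_bigr => i _.
rewrite linearZ/= !hornerE.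
under eq_Rintegral do rewrite hornerZ.
rewrite meanZ// -mulrBr -mulrA; congr (_ * _).
case: (nat_of_ord i) => [|n].
  under eq_Rintegral do rewrite expr0 derivC horner0.
  by rewrite mean_cst !expr0 subrr mul0r.
rewrite expr1n -(moment_value n f1) derivXn.
under eq_Rintegral do rewrite hornerMn hornerXn -mulr_natl.
by rewrite meanZ//; exact/bounded_mfunX/bc.
Qed.

End moments.

(** * The measure of a cap *)

Section cap.
Context (R : realType) (mu : probability (SO3 R) R).
Hypothesis mu_Haar : normalized_Haar mu.

(** Archimedes' hat-box theorem, obtained by rescaling the coordinate from
    [-1, 1] to [0, 1]. *)
Lemma Haar_cap (u w : 'cV[R]_3) (t : R) :
  dot u u = 1 -> dot w w = 1 -> -1 <= t <= 1 ->
  mu [set g | t < dot w (SO3_mx g *m u)] = ((1 - t) / 2)%:E.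
Proof.
move=> u1 w1 /andP[tN1 t1].
pose W g := (1 + dot w (SO3_mx g *m u)) / 2.
have -> : [set g | t < dot w (SO3_mx g *m u)] = [set g | (1 + t) / 2 < W g].
  by apply/seteqP; split=> g; rewrite /W /=; lra.
have mW : measurable_fun [set: SO3 R] W.
  apply: measurable_funM; last exact: measurable_cst.
  by apply: measurable_funD; [exact: measurable_cst|exact: measurable_SO3_dot].
have W01 g : 0 <= W g <= 1.
  have := dot_itv w1 (_ : dot (SO3_mx g *m u) _ = 1).
  by rewrite SO3_dot => /(_ u1)/andP[? ?]; apply/andP; rewrite /W; lra.
have bW : bounded_mfun W.
  by split=> //; exists 1 => g; have /andP[W0 W1] := W01 g; rewrite ger0_norm.
rewrite uniform_tail//.
- by congr (_%:E); field.
- move=> q; pose h : {poly R} := (1 / 2)%:P * (1 + 'X).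
  have hE x : h.[x] = (1 + x) / 2.
    by rewrite hornerM hornerD !hornerC hornerX; ring.
  have := mean_deriv mu_Haar u1 (q \Po h) w1.
  rewrite !horner_comp !hE deriv_comp.
  under eq_Rintegral do rewrite hornerM horner_comp hE.
  have -> : h^`() = (1 / 2)%:P.
    by rewrite derivM derivC derivD derivX derivC mul0r !add0r mulr1.
  under eq_Rintegral do rewrite hornerC mulrC.
  rewrite meanZ; last exact: (bounded_mfun_horner q^`() bW).
  have -> : (1 + 1) / 2 = 1 :> R by field.
  rewrite subrr mul0r => /(congr1 (fun x => x * 2)).
  by rewrite divfK// mul1r mulrC mulrA divff// mul1r.
- by apply/andP; lra.
Qed.

End cap.

(** * Products of caps *)

Section product_of_caps.
Context (R : realType).

Definition rotation_cap (u : 'cV[R]_3) (t : R) : set (SO3 R) :=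
  [set g | t < dot u (SO3_mx g *m u)].

Lemma rotation_nbhd_cap u theta : dot u u = 1 -> 0 <= theta <= pi ->
  rotation_nbhd u theta = rotation_cap u (cos theta).
Proof.
move=> u1 theta_itv; apply/seteqP.
suff E g : (angle u (SO3_mx g *m u) < theta) =
           (cos theta < dot u (SO3_mx g *m u)).
  by split=> g; rewrite /rotation_nbhd /rotation_cap /= E.
have d_itv : -1 <= dot u (SO3_mx g *m u) <= 1 by rewrite dot_itv ?SO3_dot.
rewrite /angle -ltr_cos ?in_itv//= ?acosK ?in_itv//.
by rewrite acos_ge0 ?acos_lepi.
Qed.

Lemma measurable_rotation_cap u t : measurable (rotation_cap u t).
Proof. exact: measurable_superlevel (@measurable_SO3_dot R u u). Qed.

(** With [c = cos theta], the right-hand side is the cap of height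
    [cos (2 theta)]: angles at most add up under products, and a rotation [k]
    is recovered from two factors by first moving [u] to the midpoint of the
    arc from [u] to [k u]. *)
Lemma prodset_rotation_cap u (c : R) : dot u u = 1 -> 0 <= c ->
  prodset (rotation_cap u c) (rotation_cap u c) =
  rotation_cap u (2 * c ^+ 2 - 1).
Proof.
move=> u1 c0; apply/seteqP; split=> [_ [a /= ac [b /= bc <-]]|k /= kc].
  rewrite /rotation_cap /= -mulmxA dotC dot_mulmx dotC.
  set x := (SO3_mx a)^T *m u; set y := SO3_mx b *m u.
  have x1 : dot x x = 1 by rewrite -[x]/(SO3_mx (SO3_inv a) *m u) SO3_dot.
  have y1 : dot y y = 1 by rewrite SO3_dot.
  have ux : dot u x = dot u (SO3_mx a *m u) by rewrite [RHS]dotC dot_mulmx.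
  (* With [p = u . x] and [q = u . y], the components of [x] and [y]
     orthogonal to [u] have squared norms [1 - p^2] and [1 - q^2]; as the
     squared norm of their sum is nonnegative,
     [x . y >= (p + q)^2 / 2 - 1 > 2 c^2 - 1]. *)
  have := dot_ge0 (x + y + (- (dot u x + dot u y)) *: u).
  rewrite !(dotDl, dotDr, dotZl, dotZr) x1 y1 u1.
  rewrite (dotC y x) (dotC x u) (dotC y u).
  rewrite /rotation_cap /= -ux in ac; rewrite /rotation_cap /= -/y in bc.
  move: (dot u x) (dot u y) (dot x y) ac bc => p q r pc qc; nra.
rewrite /rotation_cap /= in kc; set d := dot _ _ in kc.
have d1 : 0 < 1 + d by have := sqr_ge0 c; lra.
have w2 : dot (u + SO3_mx k *m u) (u + SO3_mx k *m u) = 2 * (1 + d).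
  by rewrite !(dotDl, dotDr) SO3_dot u1 (dotC _ u) -/d; ring.
have w0 : u + SO3_mx k *m u != 0.
  apply/eqP => w0; move: w2; rewrite w0 -(scale0r u) dotZl mul0r => /esym/eqP.
  by rewrite mulf_eq0 gt_eqF//= gt_eqF.
have [s s0 [m1 s2]] := unit_vector_normalize w0; rewrite w2 in s2.
have cs : c < s^-1 * (1 + d).
  have -> : 1 + d = s ^+ 2 / 2 by rewrite s2; field.
  rewrite expr2 -!mulrA mulKf ?gt_eqF//; nra.
have [g gu] := SO3_transitive u1 m1.
exists g; first by rewrite /rotation_cap /= gu dotZr dotDr u1.
exists (g^-1 * k)%g; last by rewrite mulVKg.
rewrite /rotation_cap /= -(SO3_dot g) gu mulmxA.
rewrite (_ : SO3_mx g *m _ = SO3_mx k); last first.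
  by rewrite -[LHS]/(SO3_mx (g * (g^-1 * k))%g) mulVKg.
by rewrite dotZl dotDl SO3_dot u1 addrC.
Qed.

End product_of_caps.

Theorem proposition3p6 (R : realType) (mu : probability (SO3 R) R)
    (mu_Haar : normalized_Haar mu) :
  (forall (u : 'cV[R]_3) (theta : R),
     unit_vector u -> 0 < theta <= pi / 2 ->
     let A := rotation_nbhd u theta in
     [/\ measurable A, measurable (prodset A A),
         mu (prodset A A) = (4%:E * mu A * (1 - mu A))%E
       & (mu (prodset A A) < 4%:E * mu A)%E])
  /\ (forall delta : R, 0 < delta ->
      exists (u : 'cV[R]_3) (theta : R),
        [/\ unit_vector u, 0 < theta <= pi / 2
          & (mu (rotation_nbhd u theta) < delta%:E)%E]).
Proof.
have pi0 := @pi_gt0 R.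
split.
  move=> u theta /unit_vectorE u1 /andP[theta0 theta_le] A.
  have theta_itv : 0 <= theta <= pi by apply/andP; lra.
  rewrite /A rotation_nbhd_cap//; set c := cos theta.
  have c0 : 0 <= c by apply: cos_ge0_pihalf; apply/andP; lra.
  have c1 : c < 1.
    by rewrite -[ltRHS]cos0 ltr_cos// in_itv/= ?lexx// ltW.
  rewrite prodset_rotation_cap//.
  have cap t : -1 <= t <= 1 -> mu (rotation_cap u t) = ((1 - t) / 2)%:E.
    exact: Haar_cap.
  rewrite !cap; [|apply/andP; nra..].
  split; [exact: measurable_rotation_cap..| |].
    by rewrite -EFinB -!EFinM; congr (_%:E); field.
  by rewrite -EFinM lte_fin; nra.
move=> delta delta0.
(* The cap of height [c] has measure at most [delta / 2]; the maximum with 0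
   keeps its angle within [pi / 2]. *)
pose c : R := Num.max 0 (1 - delta).
have c0 : 0 <= c by rewrite le_max lexx.
have c1 : c < 1 by rewrite gt_max ltr01 ltrBlDr ltrDl.
have cd : 1 - delta <= c by rewrite le_max lexx orbT.
have c_itv : -1 <= c <= 1 by apply/andP; lra.
have u1 : dot (vec3 1 0 0) (vec3 1 0 0) = 1 :> R.
  by rewrite dot_vec3 !mxE /=; ring.
exists (vec3 1 0 0), (acos c); split; first exact/unit_vectorE.
  rewrite acos_gt0 ?c1 ?andbT//=; last by lra.
  rewrite leNgt -ltr_cos ?in_itv/= ?acos_ge0 ?acos_lepi//; last first.
    by apply/andP; lra.
  by rewrite acosK ?in_itv// cos_pihalf -leNgt.
rewrite rotation_nbhd_cap// ?acos_ge0 ?acos_lepi// acosK ?in_itv//.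
by rewrite Haar_cap// lte_fin; lra.
Qed.
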